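(* Let $A$ be an Abelian group, let $G=(V,E)$ be a weakly connected directed graph (loops and multiple edges allowed), and let $G'$ be its underlying undirected graph. Let $\mathcal{BF}(V,A)$ be the group of balanceable functions on the vertices of $G$ in the flexible case. If $G'$ is bipartite, then $\mathcal{BF}(V,A)$ is isomorphic to $A$. If $G'$ is not bipartite, then $\mathcal{BF}(V,A)$ is isomorphic to $A_2=\{a\in A: 2a=0\}$.
   Context: The Abelian group $A$ is written additively with identity $0$. A directed graph $G=(V,E)$ has a nonempty vertex set $V$ and a set $E$ of directed edges, each with an origin and an endpoint in $V$; loops and multiple edges are allowed. It is weakly connected if its underlying undirected graph is connected. An undirected graph with a loop is not bipartite. Flexible case. For each $e\in E$ from $v$ to $w$, let $\bar e$ denote the same edge taken in the opposite direction, going from $w$ to $v$; $\bar e$ is regarded as an element different from $e$ (also when $e$ is a loop), and $\bar{\bar e}=e$. Let $\mathbb{E}=\{e,\bar e : e\in E\}$. A path from a vertex $x$ to a vertex $y$ is an alternating sequence $v_1,e_1,v_2,e_2,\dots,v_n,e_n$ of vertices from $V$ and pairwise different edges from $\mathbb{E}$ such that $v_1=x$, each $e_j$ for $j=1,\dots,n-1$ goes from $v_j$ to $v_{j+1}$, and $e_n$ goes from $v_n$ to $y$. Vertices may repeat, and $e$ and $\bar e$ may both appear, since they are different elements of $\mathbb{E}$. A cycle is a path from a vertex to itself (the empty sequence is also permitted, as the trivial cycle). A function $g:V\to A$ is called balanceable if there exists a function $f:\mathbb{E}\to A$ such that $f(\bar e)=-f(e)$ for all $e\in\mathbb{E}$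 and $g(v_1)+f(e_1)+g(v_2)+f(e_2)+\dots+g(v_n)+f(e_n)=0$ for every cycle $v_1,e_1,\dots,v_n,e_n$ of $G$. The set $\mathcal{BF}(V,A)$ of all balanceable functions is a group under pointwise addition. *)

(* Defs.v *)
From Stdlib Require List.
From Stdlib Require Import Relation_Operators.
From HB Require Import structures.
From mathcomp Require Import all_boot all_order all_algebra.
From mathcomp Require Import all_classical.
Set Implicit Arguments.
Unset Strict Implicit.
Unset Printing Implicit Defensive.
Import GRing.Theory.
Local Open Scope classical_set_scope.
Local Open Scope ring_scope.

(* Vertices and edges may be infinite in number; since edges form a type of
   their own, loops and multiple edges are allowed. *)
Record digraph := Digraph {
  vertex : Type;
  edge : Type;
  origin : edge -> vertex;
  endpoint : edge -> vertex;
  vertex_nonempty : inhabited vertex }.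

(* A loop is an edge whose set of ends is a singleton. *)
Record ugraph := Ugraph {
  uvertex : Type;
  uedge : Type;
  ends : uedge -> set uvertex;
  endsP : forall e, exists x y, ends e = [set x; y] }.

Section Undirected.
Variable H : ugraph.

Definition adjacent (x y : uvertex H) : Prop :=
  exists e : uedge H, ends e = [set x; y].

Definition connected_ugraph : Prop :=
  forall x y : uvertex H, clos_refl_trans (uvertex H) adjacent x y.

Definition bipartite : Prop :=
  exists X Y : set (uvertex H),
    [/\ X `|` Y = setT, X `&` Y = set0 &
        forall e : uedge H, exists x y, [/\ X x, Y y & ends e = [set x; y]]].
End Undirected.

Section Flexible.
Variable G : digraph.

Lemma underlying_ends (e : edge G) :
  exists x y, [set origin e; endpoint e] = [set x; y].
Proof. by exists (origin e), (endpoint e). Qed.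

Definition underlying : ugraph := Ugraph underlying_ends.

Definition weakly_connected : Prop := connected_ugraph underlying.

(* [Fwd e] is the edge [e] itself and [Bwd e] is the same edge taken in the
   opposite direction; the two are different elements, even for a loop. *)
Inductive dart := Fwd of edge G | Bwd of edge G.

Definition bar (d : dart) : dart :=
  match d with Fwd e => Bwd e | Bwd e => Fwd e end.

Definition dorigin (d : dart) : vertex G :=
  match d with Fwd e => origin e | Bwd e => endpoint e end.

Definition dendpoint (d : dart) : vertex G :=
  match d with Fwd e => endpoint e | Bwd e => origin e end.

(* The alternating sequence v_1, e_1, ..., v_n, e_n is stored as the sequence
   of the pairs (v_j, e_j); the empty sequence leads from x to x. *)
Fixpoint walk (x : vertex G) (p : seq (vertex G * dart)) (y : vertex G) : Prop :=
  match p with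
  | [::] => x = y
  | (v, d) :: p' => [/\ v = x, dorigin d = v & walk (dendpoint d) p' y]
  end.

Definition is_path (x y : vertex G) (p : seq (vertex G * dart)) : Prop :=
  walk x p y /\ List.NoDup [seq s.2 | s <- p].

Definition is_cycle (p : seq (vertex G * dart)) : Prop :=
  exists x, is_path x x p.

Variable A : zmodType.

Definition balanceable (g : vertex G -> A) : Prop :=
  exists f : dart -> A,
    (forall d, f (bar d) = - f d) /\
    (forall p, is_cycle p -> \sum_(s <- p) (g s.1 + f s.2) = 0).

Definition balanceable_pred : {pred vertex G -> A} :=
  [pred g | `[< balanceable g >]].

Lemma balanceableP g : reflect (balanceable g) (g \in balanceable_pred).
Proof. exact: asboolP. Qed.

Lemma balanceable_zmod_closed : zmod_closed balanceable_pred.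
Proof.
split=> [|g h].
  apply/balanceableP; exists (fun=> 0); split=> [d|p _].
    by rewrite oppr0.
  by rewrite big1 // => s _; rewrite addr0.
move=> /balanceableP[f [fN fC]] /balanceableP[k [kN kC]].
apply/balanceableP; exists (fun d => f d - k d); split=> [d|p pC].
  by rewrite fN kN opprD.
transitivity (\sum_(s <- p) (g s.1 + f s.2) - \sum_(s <- p) (h s.1 + k s.2)).
  by rewrite -sumrB; apply: eq_bigr => s _; rewrite opprD addrACA.
by rewrite fC // kC // subr0.
Qed.

HB.instance Definition _ :=
  GRing.isZmodClosed.Build (vertex G -> A) balanceable_pred
    balanceable_zmod_closed.

(* The group BF(V, A), as a subgroup of the group of functions V -> A. *)
Record BF := MkBF {
  BF_fun : vertex G -> A;
  BF_funP : BF_fun \in balanceable_pred }.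

HB.instance Definition _ := [isSub for BF_fun].
HB.instance Definition _ := [Choice of BF by <:].
HB.instance Definition _ := [SubChoice_isSubZmodule of BF by <:].
End Flexible.

Section TwoTorsion.
Variable A : zmodType.

Definition two_torsion_pred : {pred A} := [pred a | a *+ 2 == 0].

Lemma two_torsionP a : reflect (a *+ 2 = 0) (a \in two_torsion_pred).
Proof. exact: eqP. Qed.

Lemma two_torsion_zmod_closed : zmod_closed two_torsion_pred.
Proof.
split=> [|a b]; first by apply/two_torsionP; rewrite mul0rn.
move=> /two_torsionP a0 /two_torsionP b0; apply/two_torsionP.
by rewrite mulrnBl a0 b0 subr0.
Qed.

HB.instance Definition _ :=
  GRing.isZmodClosed.Build A two_torsion_pred two_torsion_zmod_closed.

Record two_torsion := MkTwoTorsion {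
  two_torsion_val : A;
  two_torsion_valP : two_torsion_val \in two_torsion_pred }.

HB.instance Definition _ := [isSub for two_torsion_val].
HB.instance Definition _ := [Choice of two_torsion by <:].
HB.instance Definition _ := [SubChoice_isSubZmodule of two_torsion by <:].
End TwoTorsion.

Definition zmod_isomorphic (U W : zmodType) : Prop :=
  exists phi : {additive U -> W}, bijective phi.

(* Main.v *)
Require Import Defs.
From HB Require Import structures.
From mathcomp Require Import all_boot all_order all_algebra.
From mathcomp Require Import all_classical.

(** The cycle that runs along an edge [e] from [v] to [w] and back along [bar e]
    forces [g v + f e + g w - f e = 0], that is [g w = - g v]
    ([balanceable_bar]). A balanceable function thus changes sign along every
    edge, so by connectedness it is determined by its value [a] at one vertex
    [v0] and takes only the values [a] and [- a]. Evaluation at [v0] is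
    therefore an injective homomorphism from the balanceable functions to [A];
    what remains is to find its image.

    If the graph is bipartite, every [a] is reached: give one part the value
    [a], the other the value [- a], and all edges the value [0]. This balances
    because the sum along a walk telescopes ([balanceable_colored]).

    If the graph is not bipartite, the level sets of [a] and [- a] cannot be
    two disjoint parts, so [a = - a] ([balanceable_two_torsion]). Conversely,
    when [2 a = 0], giving all vertices and all edges the value [a] makes each
    step of a cycle contribute [2 a = 0] ([balanceable_const]). *)

Set Implicit Arguments.
Unset Strict Implicit.
Unset Printing Implicit Defensive.
Import GRing.Theory.
Local Open Scope classical_set_scope.
Local Open Scope ring_scope.

Lemma set2_eq (T : Type) (a b x y : T) : [set a; b] = [set x; y] ->
  (x = a /\ y = b) \/ (x = b /\ y = a).
Proof.
move=> E.
have Ha : [set x; y] a by rewrite -E; left.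
have Hb : [set x; y] b by rewrite -E; right.
have Hx : [set a; b] x by rewrite E; left.
have Hy : [set a; b] y by rewrite E; right.
by case: Ha Hb Hx Hy => /= [Ha|Ha] [Hb|Hb] [Hx|Hx] [Hy|Hy];
  solve [left; split; congruence | right; split; congruence].
Qed.

Section Balanceable.
Variables (A : zmodType) (G : digraph).
Implicit Types (g : vertex G -> A) (a : A) (v : vertex G) (d : dart G).

(** This is the only cycle condition that the classification extracts from
    balanceability. It is available even for a loop, because a loop and its
    reverse are different darts. *)
Lemma balanceable_bar g d :
  balanceable g -> g (dendpoint d) = - g (dorigin d).
Proof.
move=> [f [fN fC]].
have: is_cycle [:: (dorigin d, d); (dendpoint d, bar d)].
  exists (dorigin d); split; first by case: d.
  by constructor=> [[]|]; [case: d | | constructor; [case | constructor]].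
move=> /fC; rewrite !big_cons big_nil /= fN addr0 addrACA subrr addr0.
by move=> /eqP; rewrite addrC addr_eq0 => /eqP.
Qed.

Lemma balanceable_adjacent g x y :
  balanceable g -> @adjacent (underlying G) x y -> g y = - g x.
Proof.
move=> gB [e xyE]; case: (set2_eq xyE) => [[-> ->]|[-> ->]].
  exact: (balanceable_bar (Fwd e) gB).
exact: (balanceable_bar (Bwd e) gB).
Qed.

Lemma balanceable_values g x y : weakly_connected G -> balanceable g ->
  g y = g x \/ g y = - g x.
Proof.
move=> hG gB; elim: (hG x y) => {x y} [x y|x|x y z _ IHxy _ IHyz].
- by move=> /(balanceable_adjacent gB); right.
- by left.
- case: IHyz => ->; case: IHxy => ->; rewrite ?opprK; tauto.
Qed.

(** Connectedness leaves a balanceable function no other values than plus or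
    minus its value at [v0], so a trivial kernel gives injectivity. *)
Lemma BF_eval_inj v0 : weakly_connected G ->
  injective (fun g : BF G A => BF_fun g v0).
Proof.
move=> hG g h /= E; apply/subr0_eq/val_inj/funext => v.
have /balanceableP B := BF_funP (g - h).
have z0 : BF_fun (g - h) v0 = 0.
  by rewrite -[LHS]/(BF_fun g v0 - BF_fun h v0) E subrr.
by case: (balanceable_values v0 v hG B); rewrite z0 ?oppr0.
Qed.

(** With a base vertex in the graph, the two parts of a bipartition may be
    named so that the base vertex has colour [true]. *)
Lemma bipartite_coloring v0 : bipartite (underlying G) ->
  exists c : vertex G -> bool,
    c v0 /\ forall d, c (dendpoint d) = ~~ c (dorigin d).
Proof.
move=> [X [Y [_ XY0 XYe]]].
have Yn v : Y v -> ~ X v by move=> Yv Xv; have: set0 v by rewrite -XY0.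
pose b v := `[< X v >].
have be e : b (endpoint e) = ~~ b (origin e).
  have [x [y [Xx Yy xyE]]] := XYe e.
  have cx : b x by apply/asboolP.
  have cy : b y = false by apply/asboolF/Yn.
  by case: (set2_eq xyE) => [[<- <-]|[<- <-]]; rewrite cx cy.
exists (fun v => b v == b v0); split=> [|[] e] /=; first exact: eqxx.
  by rewrite be; case: (b _); case: (b _).
by rewrite be; case: (b _); case: (b _).
Qed.

(** The potential equal to [0] at colour [true] and [a] at colour [false]
    increases along each dart by the value at its origin, so the sum along a
    walk is the difference of potentials at its ends. *)
Lemma balanceable_colored (c : vertex G -> bool) a :
  (forall d, c (dendpoint d) = ~~ c (dorigin d)) ->
  balanceable (fun v => if c v then a else - a).
Proof.
move=> cN; exists (fun=> 0); split=> [d|p [x [+ _]]]; first by rewrite oppr0.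
pose t v := if c v then 0 else a.
suff tele y : walk x p y ->
    \sum_(s <- p) ((if c s.1 then a else - a) + 0) = t y - t x.
  by move=> /tele ->; rewrite subrr.
elim: p x => [|[v d] p IH] x /=; first by move=> ->; rewrite big_nil subrr.
move=> [-> dx /IH pE]; rewrite big_cons pE /= /t cN dx addr0 addrCA.
by case: (c x); rewrite /= ?subrr ?oppr0 ?addr0.
Qed.

(** Otherwise the level sets of [g v] and [- g v] would be disjoint, and they
    would form a bipartition. *)
Lemma balanceable_two_torsion g v : weakly_connected G ->
  ~ bipartite (underlying G) -> balanceable g -> g v *+ 2 = 0.
Proof.
move=> hG nbip gB; apply: contrapT => g2; apply: nbip.
have gNg : g v <> - g v.
  by move=> gE; apply: g2; rewrite mulr2n {2}gE subrr.
exists [set x | g x = g v], [set x | g x = - g v]; split.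
- by apply/seteqP; split=> // x _; exact: balanceable_values.
- by apply/seteqP; split=> // x [/= -> /gNg].
- move=> e /=; have ge := balanceable_bar (Fwd e) gB.
  have [go|go] := balanceable_values v (origin e) hG gB.
    by exists (origin e), (endpoint e); split; rewrite // ge /= go.
  exists (endpoint e), (origin e); split; rewrite ?ge /= ?go ?opprK //.
  exact: setUC.
Qed.

Lemma balanceable_const a : a *+ 2 = 0 -> balanceable (fun _ : vertex G => a).
Proof.
move=> a2; exists (fun=> a); split=> [_|p _].
  by apply/eqP; rewrite -addr_eq0 -mulr2n a2.
by rewrite big1 // => s _; rewrite -mulr2n.
Qed.

End Balanceable.

(** Injectivity turns the right inverse [psi] of [phi] into a two-sided one. *)
Lemma zmod_isomorphic_of_inj (U W : zmodType) (phi : U -> W) (psi : W -> U) :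
  {morph phi : x y / x - y} -> injective phi -> cancel psi phi ->
  zmod_isomorphic U W.
Proof.
move=> phiB phi_inj psiK.
pose H := GRing.isZmodMorphism.Build U W phi phiB.
pose phiA : {additive U -> W} := HB.pack phi H.
by exists phiA, psi => //; exact: inj_can_sym.
Qed.

Theorem mainTheorem2 (A : zmodType) (G : digraph) (hG : weakly_connected G) :
  (bipartite (underlying G) -> zmod_isomorphic (BF G A) A) /\
  (~ bipartite (underlying G) -> zmod_isomorphic (BF G A) (two_torsion A)).
Proof.
have [v0] := vertex_nonempty G; split.
  move=> /(bipartite_coloring v0)[c [c0 cN]].
  pose psi a : BF G A := MkBF (introT (balanceableP _) (balanceable_colored a cN)).
  apply: (@zmod_isomorphic_of_inj (BF G A) A (fun g => BF_fun g v0) psi) => //.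
  - exact: BF_eval_inj.
  - by move=> a /=; rewrite c0.
move=> nbip.
have tor (g : BF G A) : BF_fun g v0 \in @two_torsion_pred A.
  apply/two_torsionP; apply: balanceable_two_torsion => //.
  exact/balanceableP/BF_funP.
pose psi (a : two_torsion A) : BF G A :=
  MkBF (introT (balanceableP _)
    (balanceable_const G (elimT (two_torsionP _) (two_torsion_valP a)))).
apply: (@zmod_isomorphic_of_inj (BF G A) (two_torsion A)
  (fun g => MkTwoTorsion (tor g)) psi).
- by move=> g h; apply: val_inj.
- by move=> g h [/(BF_eval_inj hG)].
- by move=> a; apply: val_inj.
Qed.
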